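(* Consider the alternately shifted grid process with $\lambda=1/2$. If the data $(u_j^n)_j$ at time $n$ satisfies Hypothesis (H'), then so does the data $(u_j^{n+1})_j$ at time $n+1$. Moreover, if the initial data satisfies Hypothesis (H') and, for each $n$, $\sigma_n$ denotes the total height of the two first steps of the data at time $n$ (as defined in the context), then $\sigma_n\to+\infty$ as $n\to\infty$.
   Context: Alternately shifted grid process with $\lambda=1/2$. For $a\in\mathbf{R}$ let $\mathcal{C}_a=(a-1/2,a+1/2)$. The data at even times $n$ is a sequence $(u_j^n)_{j\in\mathbf{Z}}$; at odd times $n$ it is a sequence $(u_j^n)_{j\in\mathbf{Z}+1/2}$; $u_j^n$ is attached to the cell $\mathcal{C}_j$. Given the data at time $n$, the reconstruction $u_{rec}^n$ is defined on each cell $\mathcal{C}_j$ of the grid at time $n$ as follows. If $u_{j+1}^n\neq u_{j-1}^n$ and $d_j=\frac{u_j^n-u_{j-1}^n}{u_{j+1}^n-u_{j-1}^n}\in(0,1)$, then $u_{rec}^n(x)=u_{j-1}^n$ for $j-\frac12<x<j+\frac12-d_j$ and $u_{rec}^n(x)=u_{j+1}^n$ for $j+\frac12-d_j<x<j+\frac12$. Otherwise $u_{rec}^n=u_j^n$ on $\mathcal{C}_j$. Then $u_k^{n+1}=\int_{\mathcal{C}_k}u_{rec}^n(x)\,dx$ for all $k\in\mathbf{Z}+\frac12$ if $n$ is even, and for all $k\in\mathbf{Z}$ if $n$ is odd. Hypothesis (H'): the data $(u_j^n)_j$ at time $n$ satisfies (H') if there is an index $a$ of the grid at time $n$ (the horizontal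 translation; $a\in\mathbf{Z}$ for $n$ even, $a\in\mathbf{Z}+\frac12$ for $n$ odd) such that: (1) $u_j^n$ is constant on $\{j\le a\}$; (2) $u_{a+i}^n-u_{a+i-1}^n=1$ for every integer $i\ge3$; (3) $u_{a+2}^n-u_{a+1}^n\ge1$; (4) $u_{a+1}^n-u_a^n\ge0$. For such an index $a$ (any choice if several are possible), the total height of the two first steps is $\sigma_n=(u_{a+1}^n-u_a^n)+(u_{a+2}^n-u_{a+1}^n)$. *)

(* Defs.v *)
From HB Require Import structures.
From mathcomp Require Import all_boot all_order all_algebra.
From mathcomp Require Import all_classical all_reals all_analysis.

Set Implicit Arguments.
Unset Strict Implicit.
Unset Printing Implicit Defensive.

Import Order.TTheory GRing.Theory Num.Theory.
Import numFieldNormedType.Exports.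

Local Open Scope classical_set_scope.
Local Open Scope ring_scope.

(* The grid at time n is Z for n even and Z + 1/2 for n odd. Data at time n are
   stored as [v : int -> R], where [v k] is the value attached to the grid
   index j = [grid_point n k], that is j = k for n even and j = k + 1/2 for
   n odd. Neighbours j - 1 and j + 1 correspond to k - 1 and k + 1. *)
Definition grid_point (R : realType) (n : nat) (k : int) : R :=
  k%:~R + (odd n)%:R / 2.

Definition cell (R : realType) (c : R) : set R := `]c - 2^-1, c + 2^-1[.

Definition jump_ratio (R : realType) (v : int -> R) (k : int) : R :=
  (v k - v (k - 1)) / (v (k + 1) - v (k - 1)).

Definition reconstructs_jump (R : realType) (v : int -> R) (k : int) : bool :=
  [&& v (k + 1) != v (k - 1), 0 < jump_ratio v k & jump_ratio v k < 1].

(* The formula on the cell of index k; the value at the jump point itself is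
   immaterial and set to the right-hand one. *)
Definition cell_reconstruction (R : realType) (n : nat) (v : int -> R)
    (k : int) (x : R) : R :=
  if reconstructs_jump v k then
    if x < grid_point R n k + 2^-1 - jump_ratio v k then v (k - 1)
    else v (k + 1)
  else v k.

(* The k such that grid_point n k - 1/2 <= x < grid_point n k + 1/2. The common
   endpoints of adjacent cells, a null set, are thus assigned to the right. *)
Definition cell_index (R : realType) (n : nat) (x : R) : int :=
  Num.floor (x - (odd n)%:R / 2 + 2^-1).

Definition reconstruction (R : realType) (n : nat) (v : int -> R) (x : R) : R :=
  cell_reconstruction n v (cell_index n x) x.

Definition shifted_grid_process (R : realType) (u : nat -> int -> R) : Prop :=
  forall (n : nat) (k : int),
    u n.+1 k = (\int[lebesgue_measure]_(x in cell (grid_point R n.+1 k))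
                  reconstruction n (u n) x)%R.

(* Since only index differences matter, the same predicate serves for both
   parities, with [a : int] standing for [grid_point n a]. *)
Definition hypothesis_H'_at (R : realType) (v : int -> R) (a : int) : Prop :=
  [/\ forall j : int, j <= a -> v j = v a,
      forall i : int, 3 <= i -> v (a + i) - v (a + i - 1) = 1,
      1 <= v (a + 2) - v (a + 1) &
      0 <= v (a + 1) - v a].

Definition hypothesis_H' (R : realType) (v : int -> R) : Prop :=
  exists a : int, hypothesis_H'_at v a.

(* This depends on the choice of the translation a, which the hypothesis does
   not determine uniquely (e.g. a + 1 is also valid if v (a + 1) = v a). *)
Definition two_steps_height (R : realType) (v : int -> R) (a : int) : R :=
  (v (a + 1) - v a) + (v (a + 2) - v (a + 1)).

(* Main.v *)
(* On nondecreasing data one step of the process is the scheme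
     u^{n+1}_{j+1/2} = (u_j + u_{j+1}) / 2 + (m_j - m_{j+1}) / 2,
   where m_j is the smaller of the two jumps on either side of j. Under (H') it
   acts on the heights (p, q) of the two first steps by
     (p, q) |-> ((3p + q - 1) / 2, 1 + (q - p) / 2)   if p <= q,
     (p, q) |-> ((p - q) / 2, (p + 3q - 1) / 2)       if q < p,
   so the total height gains 1/2 in the first case and loses 1/2 in the second.
   The second case is always followed by the first, and these two steps together
   send (p, q) to (p - 3/4, q + 3/4). Hence the two cases cannot alternate
   forever, and consecutive gains recur until the height exceeds any bound. *)

Require Import Defs.
From HB Require Import structures.
From mathcomp Require Import all_boot all_order all_algebra.
From mathcomp Require Import all_classical all_reals all_analysis.
From mathcomp Require Import measurable_realfun ring lra zify.

Set Implicit Arguments.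
Unset Strict Implicit.
Unset Printing Implicit Defensive.

Import Order.TTheory GRing.Theory Num.Theory.
Import numFieldNormedType.Exports.

Local Open Scope classical_set_scope.
Local Open Scope ring_scope.

(** * Integrals of piecewise constant functions over intervals *)

(** Measurability is carried along because additivity over adjacent intervals requires it. *)
Definition has_integral (R : realType) (f : R -> R) (D : set R) (I : R) : Prop :=
  measurable_fun D f /\
  (\int[lebesgue_measure]_(x in D) (f x)%:E)%E = I%:E.

(** The boolean [b] leaves the left end open or closed: a cell is open there, whereas the right-hand
    piece of a cut interval contains the cut point. *)
Lemma has_integral_cst (R : realType) (f : R -> R) (c x y : R) (b : bool) :
  x <= y -> (forall t, x <= t -> t < y -> f t = c) ->
  has_integral f [set` Interval (BSide b x) (BLeft y)] (c * (y - x)).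
Proof.
move=> xy fc.
have fcE : {in [set` Interval (BSide b x) (BLeft y)], cst c =1 f}.
  move=> t; rewrite inE /= itv_boundlr => /andP[xt ty].
  by rewrite fc//; move: xt; case: b => //=; apply: ltW.
split.
  by apply: (eq_measurable_fun (cst c)) => //; exact: measurable_cst.
have -> : (\int[lebesgue_measure]_(t in [set` Interval (BSide b x) (BLeft y)])
            (f t)%:E = \int[lebesgue_measure]_(t in
              [set` Interval (BSide b x) (BLeft y)]) (cst c%:E) t)%E.
  by apply: eq_integral => t /fcE <-.
rewrite integral_cst// [X in (_ * X)%E]lebesgue_measure_itv /= lte_fin.
case: ltP => [_|yx]; first by rewrite -EFinD -EFinM.
by rewrite mule0 (le_anti (introT andP (conj xy yx))) subrr mulr0.
Qed.

Lemma has_integral_cat (R : realType) (f : R -> R) (a c : itv_bound R) (y I J : R) :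
  (a <= BLeft y)%O -> (BLeft y <= c)%O ->
  has_integral f [set` Interval a (BLeft y)] I ->
  has_integral f [set` Interval (BLeft y) c] J ->
  has_integral f [set` Interval a c] (I + J).
Proof.
move=> ay yc [mI eI] [mJ eJ]; rewrite (itv_bndbnd_setU ay yc).
have mU : measurable_fun ([set` Interval a (BLeft y)] `|`
    [set` Interval (BLeft y) c]) f by apply/measurable_funU.
split=> //; rewrite integral_setU//; last 2 first.
- exact/measurable_EFinP.
- apply/disj_setPS => t /= []; rewrite !itv_boundlr => /andP[_ ty] /andP[yt _].
  move: ty yt; rewrite /= !bnd_simp => ty yt.
  by have := le_lt_trans yt ty; rewrite ltxx.
by rewrite eI eJ EFinD.
Qed.

Lemma has_integral_Rintegral (R : realType) (f : R -> R) (D : set R) (I : R) :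
  has_integral f D I -> (\int[lebesgue_measure]_(x in D) f x)%R = I.
Proof. by case=> _ eI; rewrite /Rintegral eI. Qed.

Lemma cell_index_eq (R : realType) (n : nat) (k : int) (x : R) :
  grid_point R n k - 2^-1 <= x -> x < grid_point R n k + 2^-1 ->
  cell_index n x = k.
Proof.
rewrite /grid_point => h1 h2; apply: floor_def; rewrite intrD mulr1z.
by apply/andP; split; lra.
Qed.

(** * One step of the process on nondecreasing data *)

Section Step.
Variables (R : realType) (v : int -> R).

Definition min_jump (k : int) : R := Num.min (v k - v (k - 1)) (v (k + 1) - v k).

Definition minmod_average (k : int) : R :=
  (v k + v (k + 1)) / 2 + (min_jump k - min_jump (k + 1)) / 2.

Variable n : nat.

Lemma reconstruction_cell (k : int) (x : R) :
  grid_point R n k - 2^-1 <= x -> x < grid_point R n k + 2^-1 ->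
  reconstruction n v x = cell_reconstruction n v k x.
Proof. by move=> h1 h2; rewrite /reconstruction (cell_index_eq h1 h2). Qed.

Hypothesis v_nd : forall k : int, v (k - 1) <= v k.

Let nd (k : int) : v k <= v (k + 1).
Proof. by have := v_nd (k + 1); rewrite addrK. Qed.

Lemma jump_ratioM (k : int) : reconstructs_jump v k ->
  jump_ratio v k * (v (k + 1) - v (k - 1)) = v k - v (k - 1).
Proof.
by move=> /and3P[ne _ _]; rewrite /jump_ratio divfK// subr_eq0.
Qed.

(** Both jumps at [k] are nonnegative, so a ratio outside (0, 1), or a zero denominator, forces one
    of them to vanish. *)
Lemma min_jump_eq0 (k : int) : ~~ reconstructs_jump v k -> min_jump k = 0.
Proof.
have l0 := v_nd k; have r0 := nd k; rewrite /reconstructs_jump /min_jump.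
have [e|ne] /= := eqVneq (v (k + 1)) (v (k - 1)).
  by move=> _; rewrite minEle; case: ifP => _; lra.
have s0 : 0 < v (k + 1) - v (k - 1).
  by rewrite subr_gt0 lt_neqAle eq_sym ne (le_trans l0 r0).
rewrite /jump_ratio ltr_pdivlMr// mul0r ltr_pdivrMr// mul1r.
move=> nj; have {nj} [h|h] : v k - v (k - 1) <= 0 \/ v (k + 1) - v k <= 0.
  by move: nj; rewrite negb_and -!leNgt => /orP[h|h]; [left|right]; lra.
- by rewrite min_l; lra.
- by rewrite min_r; lra.
Qed.

(** The reconstructed jump sits at [g + 2^-1 - d]. It falls inside the right half exactly when
    [d < 2^-1], that is, when the left jump is the smaller one; the excess over [v k / 2] is then
    half of that jump by [jump_ratioM]. Otherwise the half is filled with [v (k + 1)]. *)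
Lemma has_integral_right_half (k : int) (b : bool) :
  has_integral (reconstruction n v)
    [set` Interval (BSide b (grid_point R n k)) (BLeft (grid_point R n k + 2^-1))]
    (v k / 2 + min_jump k / 2).
Proof.
set g := grid_point R n k.
have recE x : g <= x -> x < g + 2^-1 ->
    reconstruction n v x = cell_reconstruction n v k x.
  by move=> h1 h2; apply: reconstruction_cell => //; rewrite -/g; lra.
have [rj|nrj] := boolP (reconstructs_jump v k); last first.
  rewrite (min_jump_eq0 nrj).
  have -> : v k / 2 + 0 / 2 = v k * (g + 2^-1 - g) by field.
  apply: has_integral_cst => [|t h1 h2]; first by lra.
  by rewrite recE// /cell_reconstruction (negbTE nrj).
have dM := jump_ratioM rj; have /and3P[_ d0 d1] := rj.
set d := jump_ratio v k in dM d0 d1.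
have l0 := v_nd k; have r0 := nd k.
have [dh|dh] := leP (2^-1) d.
  have -> : v k / 2 + min_jump k / 2 = v (k + 1) * (g + 2^-1 - g).
    have h : v (k + 1) - v k <= v k - v (k - 1).
      suff: 2^-1 * (v (k + 1) - v (k - 1)) <= v k - v (k - 1) by lra.
      by rewrite -dM ler_wpM2r//; lra.
    by rewrite /min_jump min_r//; field.
  apply: has_integral_cst => [|t h1 h2]; first by lra.
  rewrite recE// /cell_reconstruction rj ltNge -/g -/d ifF//.
  by apply/negbTE; rewrite negbK; lra.
have -> : v k / 2 + min_jump k / 2 =
   v (k - 1) * (g + 2^-1 - d - g) + v (k + 1) * (g + 2^-1 - (g + 2^-1 - d)).
  have h : v k - v (k - 1) <= v (k + 1) - v k.
    suff: v k - v (k - 1) <= 2^-1 * (v (k + 1) - v (k - 1)) by lra.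
    by rewrite -dM ler_wpM2r//; lra.
  rewrite /min_jump min_l//; lra.
apply: (@has_integral_cat _ _ _ _ (g + 2^-1 - d)).
- by case: b; rewrite bnd_simp; lra.
- by rewrite bnd_simp; lra.
- apply: has_integral_cst => [|t h1 h2]; first by lra.
  by rewrite recE//; [rewrite /cell_reconstruction rj h2 | lra].
- apply: has_integral_cst => [|t h1 h2]; first by lra.
  by rewrite recE//; [rewrite /cell_reconstruction rj ltNge h1 | lra].
Qed.

(** Mirror image of the right half: what one half gains the other loses, since the reconstruction
    preserves the mean [v k] of the cell. *)
Lemma has_integral_left_half (k : int) (b : bool) :
  has_integral (reconstruction n v)
    [set` Interval (BSide b (grid_point R n k - 2^-1)) (BLeft (grid_point R n k))]
    (v k / 2 - min_jump k / 2).
Proof.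
set g := grid_point R n k.
have recE x : g - 2^-1 <= x -> x < g ->
    reconstruction n v x = cell_reconstruction n v k x.
  by move=> h1 h2; apply: reconstruction_cell => //; rewrite -/g; lra.
have [rj|nrj] := boolP (reconstructs_jump v k); last first.
  rewrite (min_jump_eq0 nrj).
  have -> : v k / 2 - 0 / 2 = v k * (g - (g - 2^-1)) by field.
  apply: has_integral_cst => [|t h1 h2]; first by lra.
  by rewrite recE// /cell_reconstruction (negbTE nrj).
have dM := jump_ratioM rj; have /and3P[_ d0 d1] := rj.
set d := jump_ratio v k in dM d0 d1.
have l0 := v_nd k; have r0 := nd k.
have [dh|dh] := leP d (2^-1).
  have -> : v k / 2 - min_jump k / 2 = v (k - 1) * (g - (g - 2^-1)).
    have h : v k - v (k - 1) <= v (k + 1) - v k.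
      suff: v k - v (k - 1) <= 2^-1 * (v (k + 1) - v (k - 1)) by lra.
      by rewrite -dM ler_wpM2r//; lra.
    by rewrite /min_jump min_l//; field.
  apply: has_integral_cst => [|t h1 h2]; first by lra.
  by rewrite recE// /cell_reconstruction rj -/g -/d ifT//; lra.
have -> : v k / 2 - min_jump k / 2 =
   v (k - 1) * (g + 2^-1 - d - (g - 2^-1)) + v (k + 1) * (g - (g + 2^-1 - d)).
  have h : v (k + 1) - v k <= v k - v (k - 1).
    suff: 2^-1 * (v (k + 1) - v (k - 1)) <= v k - v (k - 1) by lra.
    by rewrite -dM ler_wpM2r//; lra.
  rewrite /min_jump min_r//; lra.
apply: (@has_integral_cat _ _ _ _ (g + 2^-1 - d)).
- by case: b; rewrite bnd_simp; lra.
- by rewrite bnd_simp; lra.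
- apply: has_integral_cst => [|t h1 h2]; first by lra.
  by rewrite recE//; [rewrite /cell_reconstruction rj h2 | lra].
- apply: has_integral_cst => [|t h1 h2]; first by lra.
  by rewrite recE//; [rewrite /cell_reconstruction rj ltNge h1 | lra].
Qed.

(* With the indexing of [grid_point], the cell of index k at time n + 1 straddles
   the cells k, k + 1 of time n for n even, but k - 1, k for n odd. *)
Lemma integral_reconstruction (k : int) :
  (\int[lebesgue_measure]_(x in cell (grid_point R n.+1 k))
      reconstruction n v x)%R = minmod_average (k - (odd n)%:Z).
Proof.
set k' := k - (odd n)%:Z.
have c1 : grid_point R n.+1 k = grid_point R n k' + 2^-1.
  rewrite /grid_point /k' oddS; case: (odd n) => /=; rewrite ?subr0//.
    by rewrite intrD mulrN1z; lra.
  by rewrite mul0r mul1r addr0.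
have c2 : grid_point R n.+1 k = grid_point R n (k' + 1) - 2^-1.
  by rewrite c1 /grid_point intrD mulr1z; lra.
apply: has_integral_Rintegral; rewrite /cell.
have -> : minmod_average k' = (v k' / 2 + min_jump k' / 2) +
    (v (k' + 1) / 2 - min_jump (k' + 1) / 2).
  by rewrite /minmod_average; field.
(* The centre of the new cell is the common endpoint of the old cells [k'] and [k' + 1]; the new
   cell joins the right half of the former to the left half of the latter. *)
apply: (@has_integral_cat _ _ _ _ (grid_point R n.+1 k)).
- by rewrite bnd_simp; lra.
- by rewrite bnd_simp; lra.
- by rewrite {1 2}c1 addrK; exact: has_integral_right_half.
- by rewrite {1 2}c2 subrK; exact: has_integral_left_half.
Qed.

End Step.

(** * Hypothesis (H') under one step, and its choice of translation *)

Section Dynamics.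
Variable R : realType.

Lemma hypothesis_H'_at_nd (v : int -> R) (a k : int) :
  hypothesis_H'_at v a -> v (k - 1) <= v k.
Proof.
case=> cst_le step1 s2 s1; have [ka|ak] := lerP k a.
  by rewrite (cst_le k)// (cst_le (k - 1))//; lia.
have [->|[->|[i i3 ->]]] : k = a + 1 \/ k = a + 2 \/
    exists2 i : int, 3 <= i & k = a + i.
- have [h|h] := lerP k (a + 1); first by left; lia.
  have [h'|h'] := lerP k (a + 2); first by right; left; lia.
  by right; right; exists (k - a); [lia|lia].
- by rewrite addrK; lra.
- by have -> : a + 2 - 1 = a + 1 :> int; [lia|lra].
- by have := step1 i i3; lra.
Qed.

Definition first_step (v : int -> R) (a : int) : R := v (a + 1) - v a.
Definition second_step (v : int -> R) (a : int) : R := v (a + 2) - v (a + 1).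

Definition next_steps (s : R * R) : R * R :=
  if s.1 <= s.2 then ((3 * s.1 + s.2 - 1) / 2, 1 + (s.2 - s.1) / 2)
  else ((s.1 - s.2) / 2, (s.1 + 3 * s.2 - 1) / 2).

(** The shift [e] absorbs the parity-dependent indexing, so one computation serves even and odd
    times. *)
Lemma hypothesis_H'_at_minmod_average (v w : int -> R) (a e : int) :
  (forall k, w k = minmod_average v (k - e)) ->
  hypothesis_H'_at v a ->
  exists2 b : int, hypothesis_H'_at w b &
    (first_step w b, second_step w b) = next_steps (first_step v a, second_step v a).
Proof.
move=> wE H; case: (H) => cst_le step1 s2 s1.
set p := first_step v a; set q := second_step v a.
have v1 : v (a + 1) = v a + p by rewrite /p /first_step; lra.
have v2 : v (a + 2) = v a + p + q by rewrite /p /q /first_step /second_step; lra.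
have p0 : 0 <= p by [].
have q1 : 1 <= q by [].
have vS i : 2 <= i -> v (a + i + 1) = v (a + i) + 1.
  move=> i2; have := step1 (i + 1); have -> : a + (i + 1) - 1 = a + i :> int by lia.
  by rewrite addrA => h; have := h ltac:(lia); lra.
have m0 k : k <= a -> min_jump v k = 0.
  move=> ka; rewrite /min_jump (cst_le (k - 1)) ?(cst_le k) ?subrr//; last by lia.
  rewrite min_l// subr_ge0 -(cst_le k ka).
  by have := hypothesis_H'_at_nd (k + 1) H; rewrite addrK.
have m1 : min_jump v (a + 1) = Num.min p q.
  by rewrite /min_jump addrK; have -> : a + 1 + 1 = a + 2 :> int by lia.
have m2 i : 2 <= i -> min_jump v (a + i) = 1.
  move=> i2; rewrite /min_jump vS//.
  have -> : v (a + i) + 1 - v (a + i) = 1 by lra.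
  (* At [a + 2] the left jump is [q], at least 1 by condition (3), so the minimum is the right jump
     1. *)
  have [->|i3] := eqVneq i 2.
    by have -> : a + 2 - 1 = a + 1 :> int; [lia|rewrite min_r].
  by rewrite step1 ?minxx//; lia.
pose x k := minmod_average v k.
have xlt k : k <= a - 1 -> x k = v a.
  move=> ka; rewrite /x /minmod_average !m0 ?(cst_le k) ?(cst_le (k + 1)); try lia.
  by field.
have xa : x a = v a + p / 2 - Num.min p q / 2.
  by rewrite /x /minmod_average m0// m1 v1; lra.
have xa1 : x (a + 1) = v a + p + q / 2 + (Num.min p q - 1) / 2.
  rewrite /x /minmod_average m1; have -> : a + 1 + 1 = a + 2 :> int by lia.
  by rewrite m2// v1 v2; lra.
have xi i : 2 <= i -> x (a + i) = v (a + i) + 2^-1.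
  move=> i2; rewrite /x /minmod_average m2// vS//.
  have -> : a + i + 1 = a + (i + 1) :> int by lia.
  by rewrite m2; [lra | lia].
have xS i : 3 <= i -> x (a + i) - x (a + i - 1) = 1.
  move=> i3; have -> : a + i - 1 = a + (i - 1) :> int by lia.
  rewrite !xi; try lia; have := step1 i i3.
  have -> : a + i - 1 = a + (i - 1) :> int by lia.
  lra.
have wx j b : j = b + e -> w j = x b by move=> ->; rewrite wE addrK.
(* By [xa], the new value at [a] stays at the base level when [p <= q] and rises by [(p - q) / 2]
   when [q < p]. The staircase thus starts at [a] in the first case, at [a - 1] in the second. *)
rewrite /next_steps /=; case: ifPn => [pq|]; last rewrite -ltNge => pq.
  have mE : Num.min p q = p by rewrite min_l.
  have xa' : x a = v a by rewrite xa mE; lra.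
  have h1 : first_step w (a + e) = (3 * p + q - 1) / 2.
    rewrite /first_step (wx _ (a + 1)) ?(wx _ a); try lia.
    by rewrite xa' xa1 mE; lra.
  have h2 : second_step w (a + e) = 1 + (q - p) / 2.
    rewrite /second_step (wx _ (a + 2)) ?(wx (a + e + 1) (a + 1)); try lia.
    by rewrite xi// v2 xa1 mE; lra.
  exists (a + e); last by rewrite h1 h2.
  split.
  - move=> j ja; rewrite (wx _ (j - e)) ?(wx _ a) ?xa'; try lia.
    have [je|je] := eqVneq (j - e) a; first by rewrite je.
    by rewrite xlt//; lia.
  - move=> i i3; rewrite (wx _ (a + i)) ?(wx _ (a + i - 1)) ?xS//; lia.
  - by change (1 <= second_step w (a + e)); rewrite h2; lra.
  - by change (0 <= first_step w (a + e)); rewrite h1; lra.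
have mE : Num.min p q = q by rewrite min_r// ltW.
have h1 : first_step w (a - 1 + e) = (p - q) / 2.
  rewrite /first_step (wx _ a) ?(wx _ (a - 1)); try lia.
  by rewrite xa mE xlt//; lra.
have h2 : second_step w (a - 1 + e) = (p + 3 * q - 1) / 2.
  rewrite /second_step (wx _ (a + 1)) ?(wx _ a); try lia.
  by rewrite xa1 xa mE; lra.
exists (a - 1 + e); last by rewrite h1 h2.
split.
- move=> j ja; rewrite (wx _ (j - e)) ?(wx _ (a - 1)) ?xlt//; lia.
(* With the translation moved back by one, [i = 3] is the jump from [a + 1] to [a + 2], which [xS]
   does not cover; it equals 1 because [q] is the minimum. *)
- move=> i i3; have [->|i4] := eqVneq i 3.
    rewrite (wx _ (a + 2)) ?(wx _ (a + 1)); try lia.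
    by rewrite xi// v2 xa1 mE; lra.
  have -> : a - 1 + e + i - 1 = a + (i - 1) - 1 + e :> int by lia.
  by rewrite (wx _ (a + (i - 1))) ?(wx _ (a + (i - 1) - 1)) ?xS//; lia.
- by change (1 <= second_step w (a - 1 + e)); rewrite h2; lra.
- by change (0 <= first_step w (a - 1 + e)); rewrite h1; lra.
Qed.

Lemma hypothesis_H'_at_next (u : nat -> int -> R) (n : nat) (a : int) :
  shifted_grid_process u -> hypothesis_H'_at (u n) a ->
  exists2 b : int, hypothesis_H'_at (u n.+1) b &
    (first_step (u n.+1) b, second_step (u n.+1) b) =
    next_steps (first_step (u n) a, second_step (u n) a).
Proof.
move=> hu H; apply: (@hypothesis_H'_at_minmod_average _ _ _ (odd n)%:Z) (H) => k.
by rewrite hu integral_reconstruction// => k'; exact: hypothesis_H'_at_nd H.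
Qed.

(* Two valid translations differ by at most one. *)
Lemma two_steps_height_near (v : int -> R) (a b : int) :
  hypothesis_H'_at v a -> hypothesis_H'_at v b ->
  two_steps_height v a <= two_steps_height v b + 1.
Proof.
suff main c d : hypothesis_H'_at v c -> hypothesis_H'_at v d -> c <= d ->
    two_steps_height v c <= two_steps_height v d + 1 /\
    two_steps_height v d <= two_steps_height v c + 1.
  move=> Ha Hb; have [ab|/ltW ba] := lerP a b.
    by have [] := main _ _ Ha Hb ab.
  by have [] := main _ _ Hb Ha ba.
move=> [_ step1 s2 s1] [cst_le _ _ _] cd.
have [<-|ne] := eqVneq c d; first by split; lra.
(* If [d] were at least [c + 2], the data would be constant up to [c + 2], against a second step of
   at least 1 at [c]. If [d = c + 1], the first step at [c] is zero and the height at [d] is larger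
   by the unit jump that follows. *)
have [dE|ne'] := eqVneq d (c + 1); last first.
  by move: s2; rewrite (cst_le (c + 2)) ?(cst_le (c + 1)); [lra|lia|lia].
have e : v (c + 1) = v c by rewrite [RHS]cst_le dE//; lia.
have := step1 3 isT; rewrite /two_steps_height dE.
have -> : c + 1 + 1 = c + 2 :> int by lia.
have -> : c + 1 + 2 = c + 3 :> int by lia.
have -> : c + 3 - 1 = c + 2 :> int by lia.
by rewrite e => h; split; lra.
Qed.

(** * Orbits of the map on the pair of step heights *)

Definition admissible (s : R * R) : Prop := 0 <= s.1 /\ 1 <= s.2.

Lemma admissible_iter (s : R * R) (m : nat) :
  admissible s -> admissible (iter m next_steps s).
Proof.
move=> hs; elim: m => //= m; case: (iter m _ _) => p q [/= p0 /= q1].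
by rewrite /next_steps /admissible /=; case: (lerP p q) => /= pq; split; lra.
Qed.

(* The total height, with the loss of 1/2 incurred when [s.2 < s.1] charged one
   step in advance: this makes it nondecreasing along the orbit. *)
Definition potential (s : R * R) : R :=
  if s.1 <= s.2 then s.1 + s.2 else s.1 + s.2 - 2^-1.

(** A gain of 1/2 covers the charge that the next state may carry. When [s.2 < s.1], the loss is
    already charged and [1 <= s.2] puts the next state in the gaining case, so the potential is
    unchanged. *)
Lemma potential_next (s : R * R) : admissible s ->
  potential s <= potential (next_steps s).
Proof.
case: s => p q [/= p0 /= q1]; rewrite /potential /next_steps /=.
by case: (lerP p q) => pq /=; case: ifP => [|/negbT]; rewrite -?ltNge => h; lra.
Qed.

Lemma potential_iter (s : R * R) (m n : nat) : admissible s -> (m <= n)%N ->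
  potential (iter m next_steps s) <= potential (iter n next_steps s).
Proof.
move=> hs /subnK <-; elim: (n - m)%N => //= k /le_trans; apply.
exact/potential_next/admissible_iter.
Qed.

Lemma exists_nat_gt (x : R) : exists k : nat, x < k%:R.
Proof.
exists (Num.bound `|x|).
exact: le_lt_trans (ler_norm x) (archi_boundP (normr_ge0 x)).
Qed.

Lemma exists_potential_gain (s : R * R) : admissible s ->
  exists m : nat, potential s + 2^-1 <= potential (iter m next_steps s).
Proof.
(* While [r.2 < r.1], two steps lower the difference by 3/2 and keep the sum. The potential stays
   put until the order reverses, where the charge of 1/2 is released; [k] bounds the difference and
   drives the induction. *)
have descent (k : nat) (r : R * R) : admissible r -> r.2 < r.1 -> r.1 - r.2 < k%:R ->
    exists m : nat, potential r + 2^-1 <= potential (iter m next_steps r).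
  elim: k r => [|k IH] [p q] [/= p0 /= q1] qp; first by rewrite mulr0n; lra.
  rewrite -natr1 => pqk.
  have e2 : next_steps (next_steps (p, q)) = (p - 3 / 4, q + 3 / 4).
    have -> : next_steps (p, q) = ((p - q) / 2, (p + 3 * q - 1) / 2).
      by rewrite /next_steps /= lt_geF.
    by rewrite /next_steps /= ifT; [congr pair; lra | lra].
  have [h|h] := lerP (p - 3 / 4) (q + 3 / 4).
    by exists 2%N; rewrite /= e2 /potential /= h (lt_geF qp) /=; lra.
  have [|//||m hm] := IH (p - 3 / 4, q + 3 / 4); rewrite /admissible /=; [lra|lra|].
  exists m.+2; rewrite !iterSr e2; apply: le_trans hm.
  by rewrite /potential /= (lt_geF qp) (lt_geF h) /=; lra.
move=> hs; have hs1 : admissible (next_steps s) := admissible_iter 1 hs.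
have [k hk] := exists_nat_gt ((next_steps s).1 - (next_steps s).2).
(* If [s] or its successor is a losing state, [descent] applies there; otherwise [s] gains 1/2 and
   its successor carries no charge. *)
have [BA|BA] := ltrP (next_steps s).2 (next_steps s).1.
  have [m hm] := descent k _ hs1 BA hk.
  by exists m.+1; rewrite iterSr; apply: le_trans hm; rewrite lerD2r potential_next.
have [BB|BB] := ltrP s.2 s.1.
  have [k' hk'] := exists_nat_gt (s.1 - s.2).
  exact: descent hk'.
exists 1%N; rewrite /= {1}/potential BB /potential BA /next_steps BB /=; lra.
Qed.

Lemma potential_unbounded (s : R * R) (M : R) : admissible s ->
  exists m : nat, M <= potential (iter m next_steps s).
Proof.
move=> hs; have [k hk] := exists_nat_gt (2 * (M - potential s)).
have [m hm] : exists m : nat, potential s + k%:R / 2 <= potential (iter m next_steps s).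
  elim: k {hk} => [|k [m hm]]; first by exists 0%N; rewrite mul0r addr0.
  have [m' hm'] := exists_potential_gain (admissible_iter m hs).
  exists (m' + m)%N; rewrite iterD; apply: le_trans hm'; rewrite -natr1; lra.
by exists m; lra.
Qed.

End Dynamics.

Theorem proposition12 (R : realType) (u : nat -> int -> R)
    (hu : shifted_grid_process u) :
  (forall n : nat, hypothesis_H' (u n) -> hypothesis_H' (u n.+1)) /\
  (hypothesis_H' (u 0%N) ->
   forall a : nat -> int,
     (forall n : nat, hypothesis_H'_at (u n) (a n)) ->
     (fun n : nat => two_steps_height (u n) (a n)) @ \oo --> +oo).
Proof.
split=> [n [a H]|_ a Ha].
  by have [b Hb _] := hypothesis_H'_at_next hu H; exists b.
pose s := (first_step (u 0%N) (a 0%N), second_step (u 0%N) (a 0%N)).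
have hs : admissible s by have [_ _ s2 s1] := Ha 0%N.
(* The orbit follows translations [b] produced by the steps, which may differ from the given
   [a n]. *)
have orbit n : exists2 b : int, hypothesis_H'_at (u n) b &
    (first_step (u n) b, second_step (u n) b) = iter n (@next_steps R) s.
  elim: n => [|n [b Hb sb]]; first by exists (a 0%N).
  by have [b' Hb' sb'] := hypothesis_H'_at_next hu Hb; exists b'; rewrite // sb' sb.
(* The extra 1 in [A + 1] pays for replacing [b] by [a n]; the potential never exceeds the
   height. *)
apply/cvgryPge => A; have [m hm] := potential_unbounded (A + 1) hs.
exists m => // n /= mn; have [b Hb sb] := orbit n.
have := two_steps_height_near Hb (Ha n).
have := le_trans hm (potential_iter hs mn); rewrite -sb.
by rewrite /potential /two_steps_height /first_step /second_step /=;
  case: ifP => _; lra.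
Qed.
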